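(* Let $F$ be a graph with a cut-edge $e$ such that $G$ and $H$ are the components of $F-e$. If $k$ is an integer with $2\leq k<\min\{\delta(G),\delta(H)\}$, then \[ \gamma_{\times k,t}(G_I)+\gamma_{\times k,t}(H_I)-2\leq \gamma_{\times k,t}(F_I)\leq \gamma_{\times k,t}(G_I)+\gamma_{\times k,t}(H_I). \]
   Context: All graphs are finite, simple and undirected. For a graph $G$ without isolated vertices, the inflated graph $G_I$ is obtained as follows: each vertex $x_i$ of $G$ of degree $d(x_i)$ is replaced by a clique $X_i\cong K_{d(x_i)}$ whose vertices are labelled $x_ix_j$, one for each neighbour $x_j$ of $x_i$; and each edge $x_ix_j$ of $G$ is replaced by the edge joining $x_ix_j\in X_i$ to $x_jx_i\in X_j$. For an integer $k\geq1$, a set $S\subseteq V(H)$ is a $k$-tuple total dominating set of a graph $H$ if every vertex of $H$ has at least $k$ neighbours in $S$; $\gamma_{\times k,t}(H)$ denotes the minimum cardinality of such a set. *)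

(* Defs.v *)
From mathcomp Require Import all_boot.
Set Implicit Arguments.
Unset Strict Implicit.
Unset Printing Implicit Defensive.

Record sgraph := SGraph {
  vertex :> finType;
  adj : rel vertex;
  adj_sym : symmetric adj;
  adj_irrefl : irreflexive adj }.

Definition nbhd (G : sgraph) (x : G) : {set G} := [set y | adj x y].

Definition deg (G : sgraph) (x : G) : nat := #|nbhd x|.

(* Every degree is smaller than #|G|, so the neutral element #|G| only matters
   for the graph without vertices. *)
Definition min_deg (G : sgraph) : nat := \big[minn/#|G|]_(x : G) deg x.

Definition components (G : sgraph) : {set {set G}} :=
  equivalence_partition (connect (@adj G)) [set: G].

Section DeleteEdge.
Variables (G : sgraph) (x y : G).

Definition del_edge_adj : rel G :=
  fun a b => adj a b && ([set a; b] != [set x; y]).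

Fact del_edge_sym : symmetric del_edge_adj.
Proof. by move=> a b; rewrite /del_edge_adj adj_sym setUC. Qed.

Fact del_edge_irrefl : irreflexive del_edge_adj.
Proof. by move=> a; rewrite /del_edge_adj adj_irrefl. Qed.

Definition del_edge : sgraph := SGraph del_edge_sym del_edge_irrefl.
End DeleteEdge.

Definition cut_edge (G : sgraph) (x y : G) : bool :=
  adj x y && (#|components G| < #|components (del_edge x y)|).

Section Induced.
Variables (G : sgraph) (A : {set G}).

Definition induced_adj : rel {x : G | x \in A} :=
  fun u v => adj (val u) (val v).

Fact induced_sym : symmetric induced_adj.
Proof. by move=> u v; apply: adj_sym. Qed.

Fact induced_irrefl : irreflexive induced_adj.
Proof. by move=> u; apply: adj_irrefl. Qed.

Definition induced : sgraph := SGraph induced_sym induced_irrefl.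
End Induced.

(* The vertex labelled x_i x_j is the ordered pair (x_i, x_j) of adjacent
   vertices; the clique X_i is the set of pairs with first component x_i.
   Isolated vertices disappear. *)
Section Inflation.
Variable G : sgraph.

Definition inflated_adj : rel {p : G * G | adj p.1 p.2} :=
  fun u v =>
    ((val u).1 == (val v).1) && (u != v)
    || ((val u).1 == (val v).2) && ((val u).2 == (val v).1).

Fact inflated_sym : symmetric inflated_adj.
Proof.
move=> u v; rewrite /inflated_adj (eq_sym u v) (eq_sym (val u).1 (val v).1).
by congr orb; rewrite andbC (eq_sym (val u).1) (eq_sym (val u).2).
Qed.

Fact inflated_irrefl : irreflexive inflated_adj.
Proof.
case=> -[a b] /= ab; rewrite /inflated_adj /= !eqxx /=.
by apply/negP=> /andP[/eqP eab _]; rewrite eab adj_irrefl in ab.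
Qed.

Definition inflated : sgraph := SGraph inflated_sym inflated_irrefl.
End Inflation.

Definition ktuple_total_dominating (k : nat) (H : sgraph) (S : {set H}) : bool :=
  [forall x : H, k <= #|nbhd x :&: S|].

(* If H has a k-tuple total dominating set then setT is one, and the arg min is
   a genuine minimum; otherwise the value is the junk #|H|. *)
Definition gamma_kt (k : nat) (H : sgraph) : nat :=
  #|[arg min_(S < [set: H] | ktuple_total_dominating k S) #|S|]|.

(* Main.v *)
(** Let [e = xy] with [x] in [G].  Only the two vertices [xy] and [yx] of the
    inflation of [F] belong to neither [G_I] nor [H_I], and [xy] is adjacent,
    apart from [yx], exactly to the clique of [x] in [G_I].

    Upper bound: a vertex of the clique of [x] has a single neighbour outside
    the clique, so a k-tuple total dominating set [D] of [G_I] meets the clique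
    in at least [k - 1 > 0] vertices besides any given one; applied to a vertex
    of [D], this gives [k] vertices of [D] in the clique, which dominate [xy].
    Hence the union of optimal sets for [G_I] and [H_I] works for [F_I].

    Lower bound: removing [xy] from a set dominating [F_I] costs one neighbour
    to every vertex of the clique of [x].  Adding two new vertices of the clique
    repairs this; if there are no two new vertices, adding the whole clique,
    which has more than [k] vertices, does.  Each side grows by at most one. *)
Require Import Defs.
From mathcomp Require Import all_boot.

Set Implicit Arguments.
Unset Strict Implicit.
Unset Printing Implicit Defensive.

(** * Minimum k-tuple total dominating sets *)

Section Domination.
Variable (k : nat) (H : sgraph).

Lemma ktuple_total_dominatingS (S T : {set H}) :
  S \subset T -> ktuple_total_dominating k S -> ktuple_total_dominating k T.
Proof.
move=> sST /forallP dS; apply/forallP=> v.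
exact: leq_trans (dS v) (subset_leq_card (setIS _ sST)).
Qed.

Lemma gamma_ktP (S : {set H}) : ktuple_total_dominating k S ->
  exists2 D : {set H}, ktuple_total_dominating k D & #|D| = gamma_kt k H.
Proof.
move=> dS; have dT := ktuple_total_dominatingS (subsetT S) dS.
by rewrite /gamma_kt; case: arg_minnP => // D dD _; exists D.
Qed.

Lemma gamma_kt_le (S : {set H}) :
  ktuple_total_dominating k S -> gamma_kt k H <= #|S|.
Proof.
move=> dS; have dT := ktuple_total_dominatingS (subsetT S) dS.
by rewrite /gamma_kt; case: arg_minnP => // D _; apply.
Qed.

End Domination.

Lemma min_deg_le (G : sgraph) (a : G) : min_deg G <= deg a.
Proof.
rewrite /min_deg; elim: (index_enum G) (mem_index_enum a) => // b s IHs.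
rewrite inE big_cons geq_min => /predU1P[->|/IHs ->]; first by rewrite leqnn.
by rewrite orbT.
Qed.

(** * Cliques and neighbourhoods in an inflated graph *)

Section InflatedVertices.
Variable G : sgraph.
Implicit Types (a b : G) (u v : inflated G).

Definition origin u : G := (val u).1.
Definition target u : G := (val u).2.
Definition clique a : {set inflated G} := [set u | origin u == a].

Lemma inflated_adjE u v :
  adj u v = (origin u == origin v) && (u != v)
            || (origin u == target v) && (target u == origin v).
Proof. by []. Qed.

Lemma inflated_edge u : adj (origin u) (target u).
Proof. exact: (valP u). Qed.

Lemma inflated_eq u v : origin u = origin v -> target u = target v -> u = v.
Proof.
by case: u v => [[a b] ab] [[c d] cd] /= e1 e2; apply: val_inj; congr pair.
Qed.

Lemma card_clique a : #|clique a| = deg a.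
Proof.
rewrite /deg -(card_imset (mem (clique a)) val_inj).
rewrite -(card_imset (mem (nbhd a)) (f := pair a)) => [|b c []//].
apply: eq_card => -[b c]; apply/imsetP/imsetP => [[u]|[d]].
  rewrite inE => /eqP <- ->; exists (target u); first by rewrite inE inflated_edge.
  by case: u => -[].
by rewrite inE => ad [-> ->]; exists (Sub (a, d) ad); rewrite ?inE.
Qed.

Lemma clique_sub_nbhd u : clique (origin u) :\ u \subset nbhd u.
Proof.
by apply/subsetP=> v; rewrite !inE inflated_adjE eq_sym => /andP[-> /eqP ->];
  rewrite eqxx.
Qed.

(** Outside its own clique, a vertex has no neighbour but the reversed pair, which accounts for the
    successor. *)
Lemma card_nbhd_clique u (D : {set inflated G}) :
  #|nbhd u :&: D| <= #|(clique (origin u) :&: D) :\ u|.+1.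
Proof.
rewrite -(cardsID (clique (origin u))) -addn1 leq_add //.
  apply/subset_leq_card/subsetP=> v; rewrite !inE => /andP[/andP[uv ->] ->].
  by rewrite !andbT; apply: contraTneq uv => ->; rewrite adj_irrefl.
apply/card_le1_eqP => v w.
have out z : z \in (nbhd u :&: D) :\: clique (origin u) ->
  origin z = target u /\ target z = origin u.
  rewrite !inE inflated_adjE (eq_sym (origin z)) => /andP[/negPf ->] /=.
  by case/andP=> /andP[/eqP -> /eqP ->].
by move=> /out[ov tv] /out[ow tw]; apply: inflated_eq; rewrite ?ov ?tv.
Qed.

(** The rest of the clique of a vertex already supplies [k] neighbours. Hence dominating sets exist
    and [gamma_kt] is a genuine minimum. *)
Lemma inflated_setT_dominating k : (forall a, k < deg a) ->
  ktuple_total_dominating k [set: inflated G].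
Proof.
move=> kdeg; apply/forallP=> u; rewrite setIT.
apply: leq_trans (subset_leq_card (clique_sub_nbhd u)).
have := kdeg (origin u); rewrite -card_clique (cardsD1 u) inE eqxx.
by rewrite add1n ltnS.
Qed.

End InflatedVertices.

(* [h] identifies [H] with an induced subgraph of [F] joined to the rest of [F]
   by the single edge from [h s] to [t]. *)
Definition pendant_embedding (H F : sgraph) (h : H -> F) (s : H) (t : F) :=
  [/\ injective h, forall a b, adj (h a) (h b) = adj a b,
      adj (h s) t, t \notin codom h
    & forall a b, adj (h a) b -> b \in codom h \/ a = s /\ b = t].

(** * One side of the bridge *)

Section PendantEmbedding.
Variables (H F : sgraph) (h : H -> F) (s : H) (t : F) (k : nat).
Hypothesis hP : pendant_embedding h s t.
Hypothesis kdeg : k < deg s.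

Fact inflate_subproof (u : inflated H) : adj (h (origin u)) (h (target u)).
Proof. by case: hP => _ -> _ _ _; apply: inflated_edge. Qed.

Definition inflate (u : inflated H) : inflated F :=
  Sub (h (origin u), h (target u)) (inflate_subproof u).

Fact pendant_subproof : adj (h s, t).1 (h s, t).2.
Proof. by case: hP. Qed.

(** The vertex [xy] of the overview: the clique of [h s] consists of the image of the clique of [s]
    and of this vertex. *)
Definition pendant : inflated F := Sub (h s, t) pendant_subproof.

Lemma origin_inflate u : origin (inflate u) = h (origin u).
Proof. by []. Qed.

Lemma origin_pendant : origin pendant = h s.
Proof. by []. Qed.

Let h_inj : injective h. Proof. by case: hP. Qed.

Lemma inflate_inj : injective inflate.
Proof.
by move=> u v [] /h_inj e1 /h_inj e2; apply: inflated_eq.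
Qed.

Lemma inflate_adj u v : adj (inflate u) (inflate v) = adj u v.
Proof.
rewrite !inflated_adjE (inj_eq inflate_inj) /origin /target /=.
by rewrite !(inj_eq h_inj).
Qed.

Lemma pendant_adj u : adj (inflate u) pendant = (u \in clique s).
Proof.
have tNh a : (h a == t) = false.
  by apply/eqP=> ht; case: hP => _ _ _ /negP[]; rewrite -ht codom_f.
rewrite inflated_adjE /origin /target /= tNh /= orbF (inj_eq h_inj) inE.
rewrite andb_idr // => _; apply/eqP=> /(congr1 (@target F)) /eqP.
by rewrite /target /= tNh.
Qed.

Lemma pendantN u : inflate u != pendant.
Proof.
apply/eqP=> /(congr1 (@target F)); rewrite /target /= => ht.
by case: hP => _ _ _ /negP[]; rewrite -ht codom_f.
Qed.

Lemma origin_codomP (r : inflated F) :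
  origin r \in codom h -> r = pendant \/ exists u, r = inflate u.
Proof.
case/codomP=> a ra; have := inflated_edge r; rewrite ra => ab.
case: hP => _ hadj _ _ /(_ _ _ ab) [/codomP[b rb]|[as_ rt]]; last first.
  by left; apply: inflated_eq; rewrite ?ra ?as_.
have Hab : adj a b by rewrite -hadj -rb.
by right; exists (Sub (a, b) Hab); apply: inflated_eq.
Qed.

(** A neighbour has origin [h (origin u)] or [h (target u)], and both lie in the image of [h]. *)
Lemma inflate_neighbours (u : inflated H) (r : inflated F) :
  adj (inflate u) r -> r = pendant \/ exists v, r = inflate v.
Proof.
rewrite inflated_adjE => /orP[/andP[/eqP ru _]|/andP[_ /eqP ru]];
  apply: origin_codomP; rewrite -ru; first exact: (codom_f h (origin u)).
exact: (codom_f h (target u)).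
Qed.

Lemma inflate_dominates (D : {set inflated H}) (r : inflated F) :
  1 < k -> ktuple_total_dominating k D -> origin r \in codom h ->
  k <= #|nbhd r :&: inflate @: D|.
Proof.
move=> k_gt1 /forallP dD /origin_codomP[|[u]] ->; last first.
  apply: leq_trans (dD u) _; rewrite -(card_imset _ inflate_inj).
  apply/subset_leq_card/subsetP=> _ /imsetP[v /setIP[uv Dv] ->].
  by move: uv; rewrite !inE inflate_adj => ->; apply: imset_f.
have cliqueD u : u \in clique s -> k <= #|(clique s :&: D) :\ u|.+1.
  by move=> us; apply: leq_trans (dD u) _; rewrite inE in us;
    rewrite -(eqP us) card_nbhd_clique.
have [u us] : exists u, u \in clique s.
  by apply/set0Pn; rewrite -card_gt0 card_clique; apply: leq_trans kdeg.
(* Here [1 < k] matters: it gives a vertex [v] of [D] in the clique, and counting [v] itself makes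
   up for the neighbour of [v] outside the clique. *)
have /card_gt0P[v] : 0 < #|(clique s :&: D) :\ u|.
  by rewrite -ltnS; apply: leq_trans (cliqueD _ us).
rewrite inE => /andP[_ vsD].
have : k <= #|clique s :&: D|.
  by rewrite (cardsD1 v) vsD; apply: cliqueD; case/setIP: vsD.
move/leq_trans; apply; rewrite -(card_imset _ inflate_inj).
apply/subset_leq_card/subsetP=> _ /imsetP[w /setIP[ws Dw] ->].
by rewrite inE imset_f // inE adj_sym pendant_adj ws.
Qed.

(** Only the part of [S] on this side is counted, so that the bounds for the two sides can be
    added. *)
Lemma restrict_dominating (S : {set inflated F}) :
  ktuple_total_dominating k S ->
  exists2 D : {set inflated H}, ktuple_total_dominating k D
    & #|D| <= #|S :&: [set r | origin r \in codom h]|.+1.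
Proof.
move=> /forallP dS; pose E := inflate @^-1: S.
(* If the pendant vertex is in [S], dropping it frees one unit, so two vertices may be added to [E]
   at a net cost of one. *)
have cardE : #|E| + (pendant \in S) <= #|S :&: [set r | origin r \in codom h]|.
  rewrite (cardsD1 pendant) !inE origin_pendant codom_f andbT addnC leq_add2l.
  rewrite -(card_imset _ inflate_inj); apply/subset_leq_card/subsetP.
  move=> _ /imsetP[u Eu ->]; rewrite !inE pendantN origin_inflate codom_f andbT.
  by rewrite inE in Eu.
have nbhdE u :
  k <= #|nbhd u :&: E| + ((u \in clique s) && (pendant \in S)).
  apply: leq_trans (dS (inflate u)) _.
  rewrite (cardsD1 pendant) inE [_ \in nbhd _]inE pendant_adj addnC leq_add2r.
  rewrite -(card_imset _ inflate_inj); apply/subset_leq_card/subsetP=> r.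
  rewrite !inE => /and3P[rp ur rS].
  case: (inflate_neighbours ur) => [/eqP|[v rv]]; first by rewrite (negPf rp).
  by subst r; rewrite imset_f // !inE -inflate_adj ur.
have [pS|pS] := boolP (pendant \in S); last first.
  exists E; last by rewrite (negPf pS) addn0 in cardE; apply: leqW.
  by apply/forallP=> u; have := nbhdE u; rewrite (negPf pS) andbF addn0.
rewrite pS addn1 in cardE.
have [/card_gt1P[v [w [vCE wCE vw]]]|small] := ltnP 1 #|clique s :\: E|.
  exists (E :|: [set v; w]); last first.
    by apply: leq_trans (leq_card_setU _ _) _; rewrite cards2 vw addn2.
  apply/forallP=> u; have := nbhdE u; rewrite pS andbT.
  have [us|_] := boolP (u \in clique s); last first.
    rewrite addn0 => /leq_trans; apply.
    by apply/subset_leq_card/setIS/subsetUl.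
  (* Two new vertices are needed because [u] may be one of them and is not its own neighbour; the
     other one, [z], replaces the pendant vertex. *)
  move=> kE; have [z [zCE zu zvw]] :
    exists z, [/\ z \in clique s :\: E, z != u & z \in [set v; w]].
    have [uv|uv] := eqVneq u v.
      by exists w; rewrite uv eq_sym vw set22.
    by exists v; rewrite eq_sym uv set21.
  apply: leq_trans kE _; rewrite (cardsD1 z (_ :&: (_ :|: _))) addnC.
  case/setDP: zCE => zs zE.
  rewrite leq_add //.
    have: z \in nbhd u.
      apply: (subsetP (clique_sub_nbhd u)); move: us zs; rewrite !inE zu.
      by move=> /eqP -> /eqP ->; rewrite eqxx.
    by move=> uz; rewrite in_setI uz in_setU zvw orbT.
  apply/subset_leq_card/subsetP=> y /setIP[uy Ey].
  by rewrite in_setD1 in_setI uy in_setU Ey !andbT; apply: contraNneq zE => <-.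
(* At most one vertex of the clique is missing from [E], so adding the whole clique is cheap. *)
exists (E :|: clique s); last first.
  have /subset_leq_card/leq_trans-> // : E :|: clique s \subset E :|: (clique s :\: E).
    by apply/subsetP=> u; rewrite !inE; case: (_ \in S).
  apply: leq_trans (leq_card_setU _ _) (leq_trans _ (leqW cardE)).
  by rewrite -addn1 leq_add2l.
apply/forallP=> u; have := nbhdE u; rewrite pS andbT.
have [us|_] := boolP (u \in clique s); last first.
  rewrite addn0 => /leq_trans; apply.
  by apply/subset_leq_card/setIS/subsetUl.
move=> _; have : k <= #|clique s :\ u|.
  by rewrite -ltnS; have := kdeg; rewrite -card_clique (cardsD1 u) us.
move/leq_trans; apply; apply/subset_leq_card/subsetP=> v vsu.
rewrite inE in_setU (subsetP (clique_sub_nbhd u)) /=.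
  by case/setD1P: vsu => _ ->; rewrite orbT.
by move: us vsu; rewrite inE => /eqP ->.
Qed.

End PendantEmbedding.

(** * Combining the two sides *)

Lemma gamma_kt_inflated_bridge (F H1 H2 : sgraph) (h1 : H1 -> F) (h2 : H2 -> F)
    (s1 : H1) (s2 : H2) (t1 t2 : F) (k : nat) :
  pendant_embedding h1 s1 t1 -> pendant_embedding h2 s2 t2 ->
  (forall z, (z \in codom h2) = (z \notin codom h1)) ->
  1 < k -> (forall a : H1, k < deg a) -> (forall a : H2, k < deg a) ->
  gamma_kt k (inflated H1) + gamma_kt k (inflated H2) - 2
    <= gamma_kt k (inflated F)
    <= gamma_kt k (inflated H1) + gamma_kt k (inflated H2).
Proof.
move=> P1 P2 codomC k_gt1 kdeg1 kdeg2.
have [D1 dD1 cD1] := gamma_ktP (inflated_setT_dominating kdeg1).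
have [D2 dD2 cD2] := gamma_ktP (inflated_setT_dominating kdeg2).
pose D := inflate P1 @: D1 :|: inflate P2 @: D2.
have dD : ktuple_total_dominating k D.
  apply/forallP=> r; have [r1|r1] := boolP (origin r \in codom h1).
    apply: leq_trans (inflate_dominates P1 (kdeg1 s1) k_gt1 dD1 r1) _.
    exact/subset_leq_card/setIS/subsetUl.
  rewrite -codomC in r1.
  apply: leq_trans (inflate_dominates P2 (kdeg2 s2) k_gt1 dD2 r1) _.
  exact/subset_leq_card/setIS/subsetUr.
apply/andP; split; last first.
  rewrite -cD1 -cD2; apply: leq_trans (gamma_kt_le dD) _.
  by apply: leq_trans (leq_card_setU _ _) _; apply: leq_add; apply: leq_imset_card.
have [S dS <-] := gamma_ktP dD.
have [E1 dE1 cE1] := restrict_dominating P1 (kdeg1 s1) dS.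
have [E2 dE2 cE2] := restrict_dominating P2 (kdeg2 s2) dS.
rewrite leq_subLR -(cardsID [set r | origin r \in codom h1] S).
have -> : S :\: [set r | origin r \in codom h1] =
          S :&: [set r | origin r \in codom h2].
  by apply/setP=> r; rewrite !inE codomC andbC.
rewrite -[2]/(1 + 1) addnACA !add1n; apply: leq_add.
  exact: leq_trans (gamma_kt_le dE1) cE1.
exact: leq_trans (gamma_kt_le dE2) cE2.
Qed.

(** * The components left by a cut-edge *)

Lemma pendant_embedding_component (F : sgraph) (x y s t : F)
    (A : {set del_edge x y}) (sA : s \in A) :
  adj s t -> [set s; t] = [set x; y] -> t \notin A ->
  (forall a b : del_edge x y, adj a b -> a \in A -> b \in A) ->
  @pendant_embedding (induced A) F val (Sub s sA) t.
Proof.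
move=> st est tA closedA; split=> //.
- exact: val_inj.
- move=> a b; rewrite /= /induced_adj /= /del_edge_adj.
  (* An edge of [F] inside [A] is not the deleted one, since [t] is outside [A]. *)
  rewrite andb_idr // => _; apply: contraNneq tA => eab.
  have : t \in [set val a; val b] by rewrite eab -est !inE eqxx orbT.
  by rewrite !inE => /orP[] /eqP ->; apply: valP.
- by apply/codomP=> -[a ta]; case/negP: tA; rewrite ta (valP a).
move=> a b ab; have [bA|bA] := boolP (b \in A).
  by left; apply/codomP; exists (Sub b bA).
(* An edge leaving [A] must be the deleted one, as [A] is closed under the remaining edges. *)
right; have [eab|neab] := eqVneq [set val a; b] [set x; y]; last first.
  case/negP: bA; apply: (closedA (val a)) (valP a).
  by rewrite /= /del_edge_adj ab.
have aNt : val a != t by apply: contraNneq tA => <-; apply: valP.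
have bNs : b != s by apply: contraNneq bA => ->.
have : val a \in [set s; t] by rewrite est -eab !inE eqxx.
have : b \in [set s; t] by rewrite est -eab !inE eqxx orbT.
rewrite !inE (negPf aNt) (negPf bNs) orbF => /= /eqP bt /eqP as_.
by split=> //; apply: val_inj.
Qed.

Lemma connect_adj_sym (G : sgraph) : connect_sym (@adj G).
Proof. by apply: sym_connect_sym; apply: adj_sym. Qed.

Lemma mem_component (G : sgraph) (C : {set G}) (a b : G) :
  C \in components G -> a \in C -> (b \in C) = connect (@adj G) a b.
Proof.
case/imsetP=> c _ ->; rewrite !inE /= => ca.
by apply: (same_connect (@connect_adj_sym G)).
Qed.

Lemma component_exists (G : sgraph) (a : G) :
  exists2 C, C \in components G & a \in C.
Proof.
exists [set b in [set: G] | connect (@adj G) a b]; first exact: imset_f.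
by rewrite !inE connect0.
Qed.

(** If the ends stayed connected, a path between them could replace the deleted edge, so
    connectivity and hence the number of components would not change. *)
Lemma cut_edge_disconnect (F : sgraph) (x y : F) :
  cut_edge x y -> ~~ connect (@adj (del_edge x y)) x y.
Proof.
case/andP=> _; apply: contraTN => cxy; rewrite -leqNgt.
have eq_conn : connect (@adj (del_edge x y)) =2 connect (@adj F).
  move=> a b; apply/idP/idP; apply: connect_sub a b => a b ab.
    by case/andP: ab => ab _; apply: connect1.
  have [eab|neab] := eqVneq [set a; b] [set x; y]; last first.
    by apply: connect1; rewrite /= /del_edge_adj ab.
  have cyx : connect (@adj (del_edge x y)) y x by rewrite connect_adj_sym.
  have: a \in [set x; y] by rewrite -eab set21.
  have: b \in [set x; y] by rewrite -eab set22.
  by move=> /set2P[] -> /set2P[] ->; rewrite ?connect0.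
rewrite /components /equivalence_partition.
by under eq_imset => a do under eq_finset => b do rewrite eq_conn.
Qed.

Theorem theorem3p2 (F : sgraph) (x y : F) (A B : {set del_edge x y}) (k : nat)
  (hcut : cut_edge x y)
  (hAB : A != B)
  (hcomp : components (del_edge x y) = [set A; B])
  (hk2 : 2 <= k)
  (hk : k < minn (min_deg (induced A)) (min_deg (induced B))) :
  gamma_kt k (inflated (induced A)) + gamma_kt k (inflated (induced B)) - 2
    <= gamma_kt k (inflated F)
    <= gamma_kt k (inflated (induced A)) + gamma_kt k (inflated (induced B)).
Proof.
have xy : adj x y by case/andP: hcut.
have xNy := cut_edge_disconnect hcut.
have A_comp : A \in components (del_edge x y) by rewrite hcomp set21.
have B_comp : B \in components (del_edge x y) by rewrite hcomp set22.
(* The components cover all vertices, and two components with a common vertex coincide. *)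
have BE (z : del_edge x y) : (z \in B) = (z \notin A).
  have [zA|zA] := boolP (z \in A); last first.
    have [C] := component_exists z.
    by rewrite hcomp => /set2P[] -> //; rewrite (negPf zA).
  apply: contraNF hAB => zB; apply/eqP/setP=> w.
  by rewrite (mem_component _ A_comp zA) (mem_component _ B_comp zB).
have closed C : C \in components (del_edge x y) ->
    forall a b : del_edge x y, adj a b -> a \in C -> b \in C.
  by move=> C_comp a b ab aC; rewrite (mem_component _ C_comp aC) connect1.
have codom_val (C : {set del_edge x y}) (z : F) :
    (z \in codom (val : induced C -> F)) = (z \in C).
  apply/codomP/idP => [[a ->]|zC]; first exact: valP.
  by exists (Sub z zC).
have codomC (z : F) : (z \in codom (val : induced B -> F)) =
                      (z \notin codom (val : induced A -> F)).
  by rewrite !codom_val BE.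
move: hk; rewrite leq_min => /andP[hkA hkB].
have kdegA (a : induced A) : k < deg a.
  exact: leq_trans hkA (min_deg_le a).
have kdegB (b : induced B) : k < deg b.
  exact: leq_trans hkB (min_deg_le b).
have yx : adj y x by rewrite adj_sym.
(* The hypotheses do not say which of [A] and [B] contains [x]; the two cases are symmetric. *)
have [xA|xA] := boolP (x \in A).
  have yA : y \notin A by rewrite (mem_component _ A_comp xA).
  have yB : y \in B by rewrite BE.
  have xB : x \notin B by rewrite BE xA.
  have PA := pendant_embedding_component xA xy erefl yA (closed _ A_comp).
  have PB := pendant_embedding_component yB yx (setUC _ _) xB (closed _ B_comp).
  exact: (gamma_kt_inflated_bridge PA PB).
have xB : x \in B by rewrite BE.
have yB : y \notin B by rewrite (mem_component _ B_comp xB).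
have yA : y \in A by rewrite BE negbK in yB.
have PA := pendant_embedding_component yA yx (setUC _ _) xA (closed _ A_comp).
have PB := pendant_embedding_component xB xy erefl yB (closed _ B_comp).
exact: (gamma_kt_inflated_bridge PA PB).
Qed.
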